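(* Assume that the real random variable $X$ has a density $p$ with bounded total variation on $\mathbb{R}$, and let $f(t)=\mathbb{E}\,e^{itX}$, $t\in\mathbb{R}$. Then $f(\pi k)=0$ for all $k\in\mathbb{Z}$, $k\ne0$, if and only if $$\sum_{k\in\mathbb{Z}}\int_{-\infty}^\infty p(2k+x)\,p(x)\,dx=\frac12.$$ *)

(* Defs.v *)
From HB Require Import structures.
From mathcomp Require Import all_boot all_order all_algebra.
From mathcomp Require Import all_classical all_reals all_analysis.
From mathcomp Require Import complex.

Set Implicit Arguments.
Unset Strict Implicit.
Unset Printing Implicit Defensive.

Import Order.TTheory GRing.Theory Num.Theory.
Import numFieldNormedType.Exports.

Local Open Scope classical_set_scope.
Local Open Scope ring_scope.
Local Open Scope complex_scope.

Definition expi (R : realType) (x : R) : R[i] := cos x +i* sin x.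

(* [fine] is harmless for integrable Z, such as the bounded one below. *)
Definition cexpectation (d : measure_display) (T : measurableType d)
    (R : realType) (P : probability T R) (Z : T -> R[i]) : R[i] :=
  fine 'E_P[fun w => complex.Re (Z w)] +i* fine 'E_P[fun w => complex.Im (Z w)].

Definition char_fun (d : measure_display) (T : measurableType d)
    (R : realType) (P : probability T R) (X : {RV P >-> R}) (t : R) : R[i] :=
  cexpectation P (fun w => expi (t * X w)).

Definition is_density (d : measure_display) (T : measurableType d)
    (R : realType) (P : probability T R) (X : {RV P >-> R}) (p : R -> R) : Prop :=
  [/\ measurable_fun [set: R] p,
      forall x, 0 <= p x &
      forall A : set R, measurable A ->
        distribution P X A = (\int[lebesgue_measure]_(x in A) (p x)%:E)%E].

Definition total_variation_line (R : realType) (p : R -> R) : \bar R :=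
  ereal_sup [set total_variation ab.1 ab.2 p | ab in [set ab : R * R | ab.1 <= ab.2]].

(* Main.v *)
(** Let [q x = sum_k p (2 k + x)] be the density of [X] modulo 2, on the period [[0, 2[].
    Unfolding integrals over the line onto one period, the correlation sum is the
    integral of [q ^ 2] over [[0, 2[], while [f (pi k)] is the [k]-th Fourier
    coefficient of [q].  As [q] has integral 1, the integral of [(q - 1/2) ^ 2] is that
    of [q ^ 2] minus 1/2, so the sum is 1/2 iff [q = 1/2] a.e.  By uniqueness of Fourier
    coefficients of integrable functions, this happens iff [f (pi k) = 0] for [k != 0].

    Uniqueness: if an integrable [r] is orthogonal to all trigonometric polynomials,
    then it is orthogonal to the indicator of [0 < w] for every trigonometric polynomial
    [w], by composing [w] with polynomials tending boundedly to a step function.  A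
    suitable [w] is positive exactly on [0 < x < y], so the primitive of [r] vanishes,
    and [r = 0] a.e. by Lebesgue differentiation. *)

Require Import Defs.
From HB Require Import structures.
From mathcomp Require Import all_boot all_order all_algebra.
From mathcomp Require Import all_classical all_reals all_analysis measurable_realfun.
From mathcomp Require Import complex.
From mathcomp Require Import ring lra.

Import Order.TTheory GRing.Theory Num.Theory.
Import numFieldNormedType.Exports.

Local Open Scope classical_set_scope.
Local Open Scope ring_scope.

(** * Fourier uniqueness on a period *)

(** Inductive, so that linear facts follow from the generators alone. The frequencies [pi * k] are
    those of period 2; [k = 0] yields the constants. *)
Inductive trig_poly {R : realType} : (R -> R) -> Prop :=
| trig_cos (k : int) : trig_poly (fun x => cos (pi * k%:~R * x))
| trig_sin (k : int) : trig_poly (fun x => sin (pi * k%:~R * x))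
| trig_add f g : trig_poly f -> trig_poly g -> trig_poly (fun x => f x + g x)
| trig_scale c f : trig_poly f -> trig_poly (fun x => c * f x).

(** * Algebra, continuity and boundedness of trigonometric polynomials *)

Section trig_poly.
Context {R : realType}.
Implicit Types (f g : R -> R).

Lemma eq_trig_poly f g : f =1 g -> trig_poly f -> trig_poly g.
Proof. by move=> /funext ->. Qed.

Lemma trig_cst (c : R) : trig_poly (fun=> c).
Proof.
apply: eq_trig_poly (trig_scale c _ (trig_cos 0)) => x.
by rewrite mulr0 mul0r cos0 mulr1.
Qed.

Let freqD (k j : int) (x : R) :
  pi * (k + j)%:~R * x = pi * k%:~R * x + pi * j%:~R * x.
Proof. by rewrite -mulrDl -[in RHS]mulrDr -rmorphD. Qed.

Let freqB (k j : int) (x : R) :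
  pi * (k - j)%:~R * x = pi * k%:~R * x - pi * j%:~R * x.
Proof. by rewrite -mulrBl -[in RHS]mulrBr -rmorphB. Qed.

(** By bilinearity it is enough to multiply generators, where the product-to-sum formulas give the
    frequencies [k + j] and [k - j]. *)
Lemma trig_mul f g : trig_poly f -> trig_poly g -> trig_poly (fun x => f x * g x).
Proof.
move=> tf tg; elim: tf => [k|k|f1 f2 _ t1 _ t2|c f1 _ t1].
- elim: tg => [j|j|g1 g2 _ t1 _ t2|c g1 _ t1].
  + apply: eq_trig_poly (trig_scale (1 / 2) _
      (trig_add _ _ (trig_cos (k + j)) (trig_cos (k - j)))) => x.
    by rewrite freqB freqD cosB cosD; lra.
  + apply: eq_trig_poly (trig_scale (1 / 2) _
      (trig_add _ _ (trig_sin (k + j)) (trig_scale (- 1) _ (trig_sin (k - j))))) => x.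
    by rewrite freqB freqD sinB sinD; lra.
  + by apply: eq_trig_poly (trig_add _ _ t1 t2) => x; rewrite mulrDr.
  + by apply: eq_trig_poly (trig_scale c _ t1) => x; rewrite mulrCA.
- elim: tg => [j|j|g1 g2 _ t1 _ t2|c g1 _ t1].
  + apply: eq_trig_poly (trig_scale (1 / 2) _
      (trig_add _ _ (trig_sin (k + j)) (trig_sin (k - j)))) => x.
    by rewrite freqB freqD sinB sinD; lra.
  + apply: eq_trig_poly (trig_scale (1 / 2) _
      (trig_add _ _ (trig_cos (k - j)) (trig_scale (- 1) _ (trig_cos (k + j))))) => x.
    by rewrite freqB freqD cosB cosD; lra.
  + by apply: eq_trig_poly (trig_add _ _ t1 t2) => x; rewrite mulrDr.
  + by apply: eq_trig_poly (trig_scale c _ t1) => x; rewrite mulrCA.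
- by apply: eq_trig_poly (trig_add _ _ t1 t2) => x; rewrite mulrDl.
- by apply: eq_trig_poly (trig_scale c _ t1) => x; rewrite mulrA.
Qed.

Lemma trig_exp f n : trig_poly f -> trig_poly (fun x => f x ^+ n).
Proof.
move=> tf; elim: n => [|n ih].
  by apply: eq_trig_poly (trig_cst 1) => x; rewrite expr0.
by apply: eq_trig_poly (trig_mul _ _ tf ih) => x; rewrite exprS.
Qed.

Lemma continuous_trig_poly f : trig_poly f -> continuous f.
Proof.
elim=> [k|k|f1 f2 _ c1 _ c2|c f1 _ c1] x.
- apply: (@continuous_comp _ _ _ (fun x => pi * k%:~R * x) cos).
    exact: mulrl_continuous.
  exact: continuous_cos.
- apply: (@continuous_comp _ _ _ (fun x => pi * k%:~R * x) sin).
    exact: mulrl_continuous.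
  exact: continuous_sin.
- by apply: continuousD; [exact: c1|exact: c2].
- by apply: continuousM; [exact: cst_continuous|exact: c1].
Qed.

Lemma trig_poly_bounded f : trig_poly f -> exists M, forall x, `|f x| <= M.
Proof.
elim=> [k|k|f1 f2 _ [M1 h1] _ [M2 h2]|c f1 _ [M1 h1]].
- by exists 1 => x; exact: cos_max.
- by exists 1 => x; exact: sin_max.
- by exists (M1 + M2) => x; rewrite (le_trans (ler_normD _ _))// lerD.
- by exists (`|c| * M1) => x; rewrite normrM ler_wpM2l.
Qed.

End trig_poly.

(** * Polynomials tending to a step function on the unit interval *)

Section step_poly.
Context {R : realType}.

(* [1 - u ^ n] to the power [2 ^ n] already tends to 1 or 0 away from [u = 1/2], but to
   [exp (-1)] at [1/2]; the extra factor [n] in the exponent makes the limit 0 there. *)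
Definition step_poly n (u : R) : R := (1 - u ^+ n) ^+ (n * 2 ^ n).

Lemma step_poly_ge0_le1 n (u : R) : 0 <= u <= 1 -> 0 <= step_poly n u <= 1.
Proof.
move=> /andP[u0 u1].
have h : 0 <= 1 - u ^+ n <= 1.
  by rewrite subr_ge0 exprn_ile1// gerBl exprn_ge0.
by case/andP: h => h0 h1; rewrite exprn_ge0// exprn_ile1.
Qed.

Lemma bernoulli_ge n (x : R) : -1 <= x -> 1 + n%:R * x <= (1 + x) ^+ n.
Proof.
move=> x1; have x0 : 0 <= 1 + x by lra.
elim: n => [|n ih]; first by rewrite mul0r addr0 expr0.
rewrite exprS; apply: le_trans (ler_wpM2l x0 ih).
rewrite -natr1; have : 0 <= n%:R * x ^+ 2 by rewrite mulr_ge0// sqr_ge0.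
by rewrite expr2; lra.
Qed.

(** With [r = s ^ 2] and [s^-1 = 1 + h], Bernoulli's inequality bounds [n * s ^ n] by [h^-1]; the
    remaining factor [s ^ n] tends to 0. *)
Lemma cvg_mul_exp (r : R) : 0 <= r < 1 -> n%:R * r ^+ n @[n --> \oo] --> 0.
Proof.
move=> /andP[]; rewrite le_eqVlt => /predU1P[<- _|r0 r1].
  apply: cvg_near_cst; near=> n.
  by rewrite expr0n gtn_eqF ?mulr0//; near: n; exact: nbhs_infty_gt.
pose s := Num.sqrt r.
have s0 : 0 < s by rewrite sqrtr_gt0.
have s1 : s < 1 by rewrite -sqrtr1 ltr_sqrt.
have sE : r = s ^+ 2 by rewrite sqr_sqrtr// ltW.
pose h := s^-1 - 1.
have h0 : 0 < h by rewrite subr_gt0 invf_gt1.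
have cs : h^-1 * s ^+ n @[n --> \oo] --> 0.
  rewrite -[X in _ --> X](mulr0 h^-1); apply: cvgM; first exact: cvg_cst.
  by apply: cvg_expr; rewrite gtr0_norm.
apply: (squeeze_cvgr _ (cvg_cst 0) cs); near=> n.
rewrite mulr_ge0 ?exprn_ge0 ?(ltW r0)//=.
have hb : n%:R * h <= s^-1 ^+ n.
  have -> : s^-1 = 1 + h by rewrite /h; lra.
  apply: le_trans (bernoulli_ge n h _); first by lra.
  by lra.
rewrite sE -exprM mulnC exprM expr2 mulrA ler_wpM2r ?exprn_ge0 ?(ltW s0)//.
rewrite -[leRHS]mul1r ler_pdivlMr// mulrAC -ler_pdivlMr ?exprn_gt0//.
by rewrite mul1r -exprVn.
Unshelve. all: by end_near. Qed.

(** For [u < 1/2], Bernoulli's inequality gives the lower bound [1 - n * (2 * u) ^ n]. For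
    [u >= 1/2], the power [2 ^ n] alone brings [1 - u ^ n] down to at most 1/2, and the extra
    exponent [n] yields the bound [(1/2) ^ n]. *)
Lemma step_poly_cvg (u : R) : 0 <= u <= 1 ->
  step_poly n u @[n --> \oo] --> ((u < 1 / 2)%R%:R : R).
Proof.
move=> u01; have /andP[u0 u1] := u01.
have [ult|uge] := ltP u (1 / 2).
  have c1 : 1 - n%:R * (2 * u) ^+ n @[n --> \oo] --> (1 : R).
    rewrite -[X in _ --> X](subr0 1); apply: cvgB; first exact: cvg_cst.
    by apply: cvg_mul_exp; lra.
  rewrite mulr1n; apply: squeeze_cvgr c1 (cvg_cst (1 : R)); near=> n.
  have /andP[_ ->] := step_poly_ge0_le1 n u u01; rewrite andbT.
  have un1 : u ^+ n <= 1 by rewrite exprn_ile1.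
  have := bernoulli_ge (n * 2 ^ n) (- u ^+ n).
  rewrite lerN2 => /(_ un1); apply: le_trans.
  by rewrite mulrN natrM natrX exprMn mulrA.
have c2 : (1 / 2 : R) ^+ n @[n --> \oo] --> (0 : R).
  by apply: cvg_expr; rewrite ger0_norm; lra.
rewrite mulr0n; apply: (squeeze_cvgr _ (cvg_cst 0) c2); near=> n.
have /andP[-> _] /= := step_poly_ge0_le1 n u u01.
have un : (1 / 2 : R) ^+ n <= u ^+ n by apply: lerXn2r; rewrite ?nnegrE//; lra.
set y := (1 / 2 : R) ^+ n in un *.
have y0 : 0 <= y by rewrite exprn_ge0//; lra.
have yE : (2 ^ n)%:R * y = 1.
  by rewrite natrX -exprMn mulrC divfK ?expr1n// pnatr_eq0.
have un1 : 0 <= 1 - u ^+ n by rewrite subr_ge0 exprn_ile1.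
rewrite /step_poly mulnC exprM; apply: lerXn2r; rewrite ?nnegrE ?exprn_ge0//.
apply: (@le_trans _ _ ((1 - y) ^+ (2 ^ n))).
  by apply: lerXn2r; rewrite ?nnegrE//; lra.
(* Since [2 ^ n * y = 1], Bernoulli's inequality gives 2 here. As [(1 - y) * (1 + y) <= 1], the same
   power of [1 - y] is then at most 1/2. *)
have hb : 2 <= (1 + y) ^+ (2 ^ n).
  by apply: le_trans (bernoulli_ge (2 ^ n) y _); rewrite ?yE; lra.
have y1 : 0 <= 1 - y by lra.
have : (1 - y) ^+ (2 ^ n) * (1 + y) ^+ (2 ^ n) <= 1.
  rewrite -exprMn exprn_ile1//.
    by rewrite mulr_ge0//; lra.
  by nra.
have := exprn_ge0 (2 ^ n) y1.
by nra.
Unshelve. all: by end_near. Qed.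

End step_poly.

(** * Integrable functions with vanishing Fourier coefficients *)

Section fourier_uniqueness.
Context {R : realType}.
Local Notation mu := (@lebesgue_measure R).
Local Notation D := (`[0%R, 2%R[%classic : set R).
Variable r : R -> R.
Hypothesis ir : mu.-integrable D (EFin \o r).

Let mr : measurable_fun D r.
Proof. by apply/measurable_EFinP; exact: measurable_int ir. Qed.

Lemma measurable_trig (w : R -> R) : trig_poly w -> measurable_fun setT w.
Proof.
by move=> tw; apply: continuous_measurable_fun; exact: continuous_trig_poly.
Qed.

Lemma integrable_trig_mul f : trig_poly f ->
  mu.-integrable D (fun x => (f x * r x)%:E).
Proof.
move=> tf; have [M hM] := trig_poly_bounded f tf.
apply: (integrableMr _ _ _ ir) => //.
  by apply: measurable_funTS; exact: measurable_trig.
exists M; split; rewrite ?num_real// => N MN x _ /=.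
exact: le_trans (hM x) (ltW MN).
Qed.

Hypothesis coscoef0 : forall k : int,
  (\int[mu]_(x in D) (cos (pi * k%:~R * x) * r x)%:E = 0)%E.
Hypothesis sincoef0 : forall k : int,
  (\int[mu]_(x in D) (sin (pi * k%:~R * x) * r x)%:E = 0)%E.

Lemma integral_trig_mul_eq0 f : trig_poly f ->
  (\int[mu]_(x in D) (f x * r x)%:E = 0)%E.
Proof.
elim=> [//|//|f1 f2 t1 e1 t2 e2|c f1 t1 e1].
  under eq_integral do rewrite mulrDl EFinD.
  by rewrite integralD// ?e1 ?e2 ?adde0//; exact: integrable_trig_mul.
under eq_integral do rewrite -mulrA EFinM.
by rewrite integralZl// ?e1 ?mule0//; exact: integrable_trig_mul.
Qed.

Let measurable_pos_trig w : trig_poly w ->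
  measurable_fun D (fun x => (0 < w x)%R%:R : R).
Proof.
move=> tw; rewrite (_ : (fun x => _) = \1_(w @^-1` `]0, +oo[%classic)); last first.
  apply/funext => x; rewrite indicE (_ : (x \in _) = (0 < w x))//.
  by apply/idP/idP; rewrite inE/= in_itv/= andbT.
apply: measurable_indic; rewrite -[X in measurable X]setTI.
exact: measurable_trig.
Qed.

(** The function [u = (1 - w) / 2] takes values in the unit interval and is below 1/2 exactly where
    [w > 0]. The trigonometric polynomials [step_poly n u] are orthogonal to [r] and tend to the
    indicator of [0 < w], with [|r|] dominating. *)
Lemma integral_pos_trig_eq0 w : trig_poly w -> (forall x, `|w x| <= 1) ->
  (\int[mu]_(x in D) ((0 < w x)%R%:R * r x)%:E = 0)%E.
Proof.
move=> tw w1.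
pose u x := 1 / 2 - w x / 2.
have u01 x : 0 <= u x <= 1 by have := w1 x; rewrite ler_norml /u; lra.
have tu : trig_poly u.
  apply: eq_trig_poly (trig_add _ _ (trig_cst (1 / 2)) (trig_scale (- (1 / 2)) _ tw)) => x.
  by rewrite /u; lra.
pose v n x := step_poly n (u x).
have tv n : trig_poly (v n).
  rewrite /v /step_poly; apply: trig_exp.
  apply: eq_trig_poly (trig_add _ _ (trig_cst 1) (trig_scale (- 1) _ (trig_exp _ n tu))) => x.
  by rewrite mulN1r.
have [|||||| _ _] := @dominated_convergence _ _ R mu D _
    (fun n x => (v n x * r x)%:E) (fun x => ((0 < w x)%R%:R * r x)%:E)
    (abse \o (EFin \o r)).
- by [].
- by move=> n; apply: measurable_int (integrable_trig_mul _ (tv n)).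
- apply/measurable_EFinP; apply: measurable_funM => //.
  exact: measurable_pos_trig.
- apply: aeW => x _; apply: cvg_EFin; first by near=> n.
  rewrite /=; apply: cvgM; last exact: cvg_cst.
  have -> : (0 < w x) = (u x < 1 / 2) by rewrite /u; apply/idP/idP; lra.
  exact: step_poly_cvg.
- exact: integrable_abse.
- apply: aeW => x n _ /=; rewrite lee_fin normrM ler_piMl//.
  by have /andP[h0 h1] := step_poly_ge0_le1 n _ (u01 x); rewrite ger0_norm.
under eq_fun do rewrite integral_trig_mul_eq0//.
by move=> /(cvg_unique _ (cvg_cst _)) <-.
Unshelve. all: by end_near. Qed.

Lemma integral_prefix_eq0 y : 0 < y < 2 ->
  (\int[mu]_(x in `[0%R, y]) (r x)%:E = 0)%E.
Proof.
move=> /andP[y0 y2].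
(* By the product formula, [w] is a trigonometric polynomial of period 2. *)
pose w (x : R) := sin (pi * x / 2) * sin (pi * (y - x) / 2).
have wE x : w x = (cos (pi * x - pi * y / 2) - cos (pi * y / 2)) / 2.
  have -> : pi * x - pi * y / 2 = pi * x / 2 - pi * (y - x) / 2 by lra.
  have -> : pi * y / 2 = pi * x / 2 + pi * (y - x) / 2 by lra.
  by rewrite cosB cosD /w; lra.
have tw : trig_poly w.
  pose c := cos (pi * y / 2) / 2; pose s := sin (pi * y / 2) / 2.
  apply: eq_trig_poly (trig_add _ _ (trig_add _ _ (trig_scale c _ (trig_cos 1))
    (trig_scale s _ (trig_sin 1))) (trig_cst (- c))) => x.
  by rewrite wE cosB /c /s mulr1; lra.
have w1 x : `|w x| <= 1.
  by rewrite normrM mulr_ile1// sin_max.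
(* The first factor of [w] is positive and the second has the sign of [y - x]. The point 0 must be
   excluded, since [w 0 = 0] although [0 < y]. *)
have wpos x : 0 < x < 2 -> (0 < w x) = (x < y).
  move=> /andP[x0 x2]; have p0 := pi_gt0 R.
  rewrite pmulr_rgt0; last by apply: sin_gt0_pi; nra.
  have [xy|yx|->] := ltgtP x y.
  - by apply: sin_gt0_pi; nra.
  - apply/negbTE; rewrite -leNgt -oppr_ge0 -sinN.
    by apply: sin_ge0_pi; nra.
  - by rewrite subrr mulr0 mul0r sin0 ltxx.
pose h x : \bar R := ((0 < w x)%R%:R * r x)%:E.
have mh : measurable_fun D h.
  apply/measurable_EFinP; apply: measurable_funM => //.
  exact: measurable_pos_trig.
have hE (x : R) : x \in (`]0%R, 2%R[%classic : set R) ->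
    h x = ((EFin \o r) \_ (`]0%R, y[%classic)) x.
  rewrite inE/= in_itv/= => x02; rewrite /h wpos// patchE.
  have /andP[x0 _] := x02.
  have [xy|yx] := ltP x y; first by rewrite mul1r mem_set//= in_itv/= x0.
  by rewrite mul0r memNset//= in_itv/= x0/= ltNge yx.
have <- : (\int[mu]_(x in D) h x = 0)%E := integral_pos_trig_eq0 w tw w1.
transitivity (\int[mu]_(x in `]0%R, y[) (r x)%:E)%E.
  rewrite integral_itv_bndoo//.
  apply/measurable_EFinP; apply: measurable_funS mr => // x /=.
  by rewrite !in_itv/= => /andP[x0 xy]; rewrite ltW//= (lt_trans xy).
transitivity (\int[mu]_(x in `]0%R, 2%R[) h x)%E; last first.
  rewrite [RHS]integral_itv_bndoo//.
  apply: measurable_funS mh => // x /=.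
  by rewrite !in_itv/= => /andP[/ltW-> ->].
transitivity (\int[mu]_(x in `]0%R, 2%R[)
    ((EFin \o r) \_ (`]0%R, y[%classic)) x)%E; last first.
  by apply: eq_integral => x /hE ->.
rewrite -integral_mkcondr.
congr integral; apply/seteqP; split => x /=; last by case.
by rewrite !in_itv/= => /andP[x0 xy]; rewrite x0 xy (lt_trans xy).
Qed.

(** By Lebesgue differentiation [r] is almost everywhere the derivative of its primitive, which
    vanishes on the open period. *)
Lemma fourier_coef_eq0_ae : {ae mu, forall x, D x -> r x = 0}.
Proof.
have irD : mu.-integrable setT (EFin \o (r \_ D)).
  rewrite -restrict_EFin.
  by apply: (integrable_mkcond _ _).1; [exact: measurable_itv|exact: ir].
have ftc := @FTC1 R (r \_ D) (BLeft 0) _ (integrable_locally (measurable_itv _) ir).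
have {}/ftc ftc : forall y, mu.-integrable `[0%R, y] (EFin \o (r \_ D)).
  by move=> y; apply: integrableS irD => //; exact: measurable_itv.
have F0 (y : R) : y \in `]0, 2[ ->
    (\int[mu]_(t in [set` `[0, y]]) (r \_ D) t)%R = 0.
  rewrite in_itv/= => /andP[y0 y2]; rewrite /Rintegral.
  rewrite (_ : (\int[mu]_(x in _) _)%E = (\int[mu]_(x in `[0%R, y]) (r x)%:E)%E).
    by rewrite integral_prefix_eq0//= y0.
  apply: eq_integral => x; rewrite inE/= in_itv/= => /andP[x0 xy].
  by rewrite patchE mem_set//= in_itv/= x0 (le_lt_trans xy).
(* The primitive is known to vanish around [x] only for interior points, so the endpoint 0 is
   discarded as a null set. *)
have n0 : {ae mu, forall x : R, x <> 0}.
  exists [set 0]; split => //; first exact: lebesgue_measure_set1.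
  by move=> x /= /contrapT.
apply: filterS2 ftc n0; first exact: (ae_filter_ringOfSetsType mu).
move=> x fx x0 /=; rewrite in_itv/= => /andP[xge0 x2].
have xgt0 : 0 < x by rewrite lt_neqAle xge0 eq_sym andbT; apply/eqP.
have x02 : x \in `]0, 2[ by rewrite in_itv/= xgt0.
have [|_] := fx; first by [].
rewrite patchE mem_set/= ?in_itv/= ?xge0// => <-.
rewrite derive1E (@near_eq_derive _ _ _ _ (cst 0)) ?derive_cst//.
by near=> y; apply: F0; near: y; exact: near_in_itvoo.
Unshelve. all: by end_near. Qed.

End fourier_uniqueness.

(** * Periodization *)

Section integer_series.
Context {R : realType}.
Local Open Scope ereal_scope.

(** The enumeration 0, -1, 1, -2, 2, ... of the integers; it turns sums over [int] into series over
    [nat], which can be integrated termwise. *)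
Definition int_of_nat (n : nat) : int := if odd n then Negz n./2 else Posz n./2.

Lemma int_of_nat_bij : set_bij [set: nat] [set: int] int_of_nat.
Proof.
split=> // [m n _ _|[n|n] _].
- move=> mn; rewrite -[RHS]odd_double_half -[LHS]odd_double_half.
  by move: mn; rewrite /int_of_nat; case: (odd m) (odd n) => [] [] // [->].
- by exists n.*2 => //; rewrite /int_of_nat odd_double doubleK.
- by exists n.*2.+1 => //; rewrite /int_of_nat/= odd_double uphalf_double.
Qed.

Lemma esum_int (a : int -> \bar R) : (forall k, 0 <= a k) ->
  \esum_(k in [set: int]) a k = \sum_(n <oo) a (int_of_nat n).
Proof.
move=> a0; rewrite (reindex_esum _ _ _ _ int_of_nat_bij).
by rewrite nneseries_esumT.
Qed.

Lemma esum_int_shift (j : int) (a : int -> \bar R) :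
  \esum_(k in [set: int]) a (k + j)%R = \esum_(k in [set: int]) a k.
Proof.
apply/esym/(reindex_esum _ _ (fun k => k + j)%R); split=> //.
  by move=> x y _ _ /addIr.
by move=> k _; exists (k - j)%R => //; rewrite subrK.
Qed.

(** The series is an integral for the counting measure, where nonnegative factors come out even when
    [c] is infinite. *)
Lemma esum_intZl (c : \bar R) (a : int -> \bar R) :
  0 <= c -> (forall k, 0 <= a k) ->
  \esum_(k in [set: int]) (c * a k) = c * \esum_(k in [set: int]) a k.
Proof.
move=> c0 a0; rewrite !esum_int// => [|k]; last exact: mule_ge0.
by rewrite -!ge0_integral_count// ?ge0_integralZl// => k; exact: mule_ge0.
Qed.

Lemma measurable_esum_int d (T : measurableType d) (D : set T) (f : int -> T -> \bar R) :
  (forall k, measurable_fun D (f k)) -> (forall k x, 0 <= f k x) ->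
  measurable_fun D (fun x => \esum_(k in [set: int]) f k x).
Proof.
move=> mf f0; under eq_fun do rewrite esum_int//.
exact: ge0_emeasurable_sum.
Qed.

Lemma integral_esum_int d (T : measurableType d)
    (mu : {measure set T -> \bar R}) (D : set T) (f : int -> T -> \bar R) :
  measurable D -> (forall k, measurable_fun D (f k)) -> (forall k x, 0 <= f k x) ->
  \int[mu]_(x in D) (\esum_(k in [set: int]) f k x) =
  \esum_(k in [set: int]) \int[mu]_(x in D) f k x.
Proof.
move=> mD mf f0; rewrite esum_int; last by move=> k; exact: integral_ge0.
under eq_integral do rewrite esum_int//.
by rewrite integral_nneseries.
Qed.

End integer_series.

(** * Translation invariance and unfolding of integrals *)

Section periodization.
Context {R : realType}.
Local Notation mu := (@lebesgue_measure R).
Local Notation D := (`[0%R, 2%R[%classic : set R).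
Local Open Scope ereal_scope.

Let measurable_translation (c : R) :
  measurable_fun [set: R] (+%R c : measurableTypeR R -> measurableTypeR R).
Proof. exact: measurable_funD. Qed.

(** By uniqueness of Lebesgue measure it is enough to compare both measures on the intervals []a,
    b]]. *)
Lemma lebesgue_measure_translation (c : R) (A : set R) : measurable A ->
  pushforward mu (+%R c : _ -> measurableTypeR R) A = mu A.
Proof.
move=> mA; have mc := measurable_translation c.
pose nu := pushforward mu (+%R c : _ -> measurableTypeR R).
apply/esym/(lebesgue_measure_unique (mu := nu)) => //= _ [[a b]] _ <-.
rewrite /nu /pushforward.
rewrite (_ : +%R c @^-1` _ = `](a - c)%R, (b - c)%R]%classic); last first.
  by apply/seteqP; split => x /=; rewrite !in_itv/= ltrBlDl lerBrDl.
by rewrite !lebesgue_measure_itv/= !lte_fin ltrD2r -!EFinB opprB addrA subrK.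
Qed.

Lemma ge0_integral_translation (c : R) (A : set R) (f : R -> \bar R) :
  measurable A -> measurable_fun A f -> (forall x, 0 <= f x) ->
  \int[mu]_(x in +%R c @^-1` A) f (c + x)%R = \int[mu]_(x in A) f x.
Proof.
move=> mA mf f0; have mc := measurable_translation c.
rewrite -(@ge0_integral_pushforward _ _ (measurableTypeR R) (measurableTypeR R) R
  (+%R c) _ mu A f)//=.
apply: eq_measure_integral => //= B mB BA; exact: lebesgue_measure_translation.
Qed.

(** Extended real values are kept because the sum may diverge at some points. *)
Definition periodization (h : R -> \bar R) (x : R) : \bar R :=
  \esum_(k in [set: int]) h (2 * k%:~R + x)%R.

Lemma periodization_ge0 h x : (forall x, 0 <= h x) -> 0 <= periodization h x.
Proof. by move=> h0; apply: esum_ge0. Qed.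

Lemma measurable_periodization h : measurable_fun [set: R] h ->
  (forall x, 0 <= h x) -> measurable_fun [set: R] (periodization h).
Proof.
move=> mh h0; apply: measurable_esum_int => // k.
apply: measurableT_comp => //; exact: measurable_funD.
Qed.

Lemma periodization_periodic h (j : int) x :
  periodization h (2 * j%:~R + x)%R = periodization h x.
Proof.
rewrite /periodization -[RHS](esum_int_shift j); apply: eq_esum => k _.
by rewrite rmorphD/= mulrDr addrA.
Qed.

(** The line is the disjoint union of the translates of [D] by even integers; each piece is moved
    back to [D], and sum and integral are exchanged by nonnegativity. *)
Lemma integral_periodization h : measurable_fun [set: R] h ->
  (forall x, 0 <= h x) ->
  \int[mu]_x h x = \int[mu]_(x in D) periodization h x.
Proof.
move=> mh h0.
pose I n := `[(2 * (int_of_nat n)%:~R)%R, (2 * (int_of_nat n)%:~R + 2)%R[%classic : set R.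
have UI : [set: R] = \bigcup_n I n.
  apply/esym; rewrite -subTset => x _.
  (* The translate containing [x] has index [floor (x / 2)]; this also gives disjointness below. *)
  have [_ _ /(_ (Num.floor (x / 2)))] := int_of_nat_bij.
  move=> /(_ Logic.I)[n _ nx]; exists n => //; rewrite /I/= in_itv/= nx.
  have := floor_itv (x / 2); rewrite intrD mulr1z.
  set f : R := (Num.floor (x / 2))%:~R; clearbody f.
  by move=> /andP[? ?]; apply/andP; split; lra.
have tI : trivIset setT I.
  apply/trivIsetP => m n _ _ mn; rewrite -subset0 => x [].
  rewrite /I/= !in_itv/= => /andP[m1 m2] /andP[n1 n2]; move/eqP: mn; apply.
  have [_ inj _] := int_of_nat_bij; apply: inj; rewrite ?inE//.
  transitivity (Num.floor (x / 2)); last first.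
    apply: floor_def; rewrite intrD mulr1z; clear m1 m2.
    by move: ((int_of_nat n)%:~R : R) n1 n2 => f ? ?; apply/andP; split; lra.
  apply/esym/floor_def; rewrite intrD mulr1z; clear n1 n2.
  by move: ((int_of_nat m)%:~R : R) m1 m2 => f ? ?; apply/andP; split; lra.
transitivity (\sum_(n <oo) \int[mu]_(x in I n) h x).
  have mI n : measurable (I n) by exact: measurable_itv.
  have := @ge0_integral_bigcup _ _ _ mu I h mI.
  by rewrite -UI; apply.
rewrite integral_esum_int//; last first.
  move=> k; apply: measurable_funTS; apply: measurableT_comp => //.
  exact: measurable_funD.
rewrite esum_int; last by move=> k; exact: integral_ge0.
apply: eq_eseriesr => n _.
rewrite -(ge0_integral_translation (2 * (int_of_nat n)%:~R)%R); last 3 first.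
- exact: measurable_itv.
- exact: measurable_funTS.
- exact: h0.
congr integral; apply/seteqP; split => x /=; rewrite /I/= !in_itv/=; lra.
Qed.

End periodization.

(** * The density of [X] modulo 2 *)

Section density.
Context {R : realType} {d : measure_display} {T : measurableType d}.
Context {P : probability T R} {X : {RV P >-> R}} {p : R -> R}.
Hypothesis hp : is_density X p.
Local Notation mu := (@lebesgue_measure R).
Local Notation D := (`[0%R, 2%R[%classic : set R).
Local Notation q := (periodization (EFin \o p)).
Local Open Scope ereal_scope.

Let mp : measurable_fun [set: R] (EFin \o p).
Proof. by case: hp => mp _ _; exact/measurable_EFinP. Qed.

Let p0 x : 0 <= (EFin \o p) x.
Proof. by case: hp => _ p0 _; rewrite lee_fin. Qed.

Lemma integral_density : \int[mu]_x (p x)%:E = 1.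
Proof. by case: hp => _ _ <- //; exact: probability_setT. Qed.

(** The density is given on sets only. The law of [X] is absolutely continuous, so expectations are
    integrals against its Radon-Nikodym derivative, which agrees almost everywhere with [p] because
    both have the same integrals over measurable sets. *)
Lemma ge0_integral_density (g : R -> \bar R) :
  measurable_fun [set: R] g -> (forall x, 0 <= g x) ->
  \int[P]_w g (X w) = \int[mu]_x (g x * (p x)%:E).
Proof.
move=> mg g0.
(* [lebesgue_measure] lives on [measurableTypeR R], whose display differs from that of the
   canonical measurable structure of [R]; [X] is repackaged with this codomain. *)
have mX : measurable_fun [set: T] (X : T -> measurableTypeR R) := measurable_funP X.
pose mXmixin := isMeasurableFun.Build _ _ _ _ _ mX.
pose X' : {mfun T >-> measurableTypeR R} := HB.pack (X : T -> measurableTypeR R) mXmixin.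
pose nu : {finite_measure set (measurableTypeR R) -> \bar R} := distribution P X'.
have nuE A : measurable A -> nu A = \int[mu]_(x in A) (p x)%:E.
  by move=> mA; case: hp => _ _ <-.
have dom : nu `<< mu.
  apply/null_content_dominatesP => A mA A0; rewrite nuE//.
  by apply: null_set_integral => //; exact: measurable_funTS.
rewrite -[LHS](ge0_integral_distribution X' mg g0).
rewrite -[LHS](@Radon_Nikodym_SigmaFinite.change_of_variables _ _ R nu mu dom
  g setT g0 measurableT mg).
have fi := @Radon_Nikodym_SigmaFinite.f_integrable _ _ R nu mu dom.
have mf := measurable_int _ fi.
apply: ge0_ae_eq_integral => //.
- exact: emeasurable_funM.
- exact: emeasurable_funM.
- by move=> x _; rewrite mule_ge0// Radon_Nikodym_SigmaFinite.f_ge0.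
- by move=> x _; rewrite mule_ge0//; exact: p0.
apply: ae_eqe_mul2l; apply: integral_ae_eq => // A _ mA.
rewrite -[LHS](Radon_Nikodym_SigmaFinite.f_integral dom)//.
exact: nuE.
Qed.

(** After unfolding, the periodic factor [g] comes out of the sum over translates, leaving [q]. *)
Lemma ge0_integral_periodic_density (g : R -> \bar R) :
  measurable_fun [set: R] g -> (forall x, 0 <= g x) ->
  (forall (k : int) x, g (2 * k%:~R + x)%R = g x) ->
  \int[mu]_x (g x * (p x)%:E) = \int[mu]_(x in D) (g x * q x).
Proof.
move=> mg g0 gper; rewrite integral_periodization//; last 2 first.
- exact: emeasurable_funM.
- by move=> x; rewrite mule_ge0//; exact: p0.
apply: eq_integral => x _; rewrite /periodization -esum_intZl//.
by apply: eq_esum => k _; rewrite gper.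
Qed.

Let mq : measurable_fun [set: R] q.
Proof. exact: measurable_periodization. Qed.

Let q0 x : 0 <= q x.
Proof. exact: periodization_ge0. Qed.

(** Summing under the integral turns the left side into the integral of [q * p] over the line; since
    [q] is itself periodic, unfolding applies with [g = q]. *)
Lemma esum_correlation :
  \esum_(k in [set: int]) \int[mu]_x (p (2 * k%:~R + x) * p x)%:E =
  \int[mu]_(x in D) (q x * q x).
Proof.
rewrite -ge0_integral_periodic_density//; last exact: periodization_periodic.
rewrite -integral_esum_int//.
- apply: eq_integral => x _; rewrite muleC -esum_intZl//; last first.
    exact: (p0 x).
  by apply: eq_esum => k _; rewrite /= -EFinM mulrC.
- move=> k; apply/measurable_EFinP; case: hp => mp' _ _.
  apply: measurable_funM => //; apply: measurableT_comp => //.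
  exact: measurable_funD.
- by case: hp => _ h _ k x; rewrite lee_fin mulr_ge0.
Qed.

Lemma integral_periodized_density : \int[mu]_(x in D) q x = 1.
Proof. by rewrite -integral_periodization// integral_density. Qed.

Lemma integrable_periodized_density : mu.-integrable D q.
Proof.
apply/integrableP; split => //; first exact: measurable_funTS.
under eq_integral => x _ do rewrite gee0_abs//.
by rewrite integral_periodized_density ltry.
Qed.

End density.

(** * Deviation of the density modulo 2 from the uniform one *)

Lemma periodicz {U V : zmodType} (f : U -> V) (t : U) : periodic f t ->
  forall (k : int) u, f (u + t *~ k) = f u.
Proof.
move=> ft [n|n] u; first exact: periodicn.
by rewrite NegzE mulrNz -[in RHS](subrK (t *~ n.+1) u) periodicn.
Qed.

(** * Trigonometric functions over one period *)

Section trig_integrals.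
Context {R : realType}.
Local Notation mu := (@lebesgue_measure R).
Local Notation D := (`[0%R, 2%R[%classic : set R).

Let freq_shift (k j : int) (x : R) :
  pi * k%:~R * (2 * j%:~R + x) = pi * k%:~R * x + (pi *+ 2) *~ (k * j).
Proof. by rewrite -[_ *~ (k * j)]mulrzr intrM; ring. Qed.

Lemma cos_freq_periodic (k j : int) (x : R) :
  cos (pi * k%:~R * (2 * j%:~R + x)) = cos (pi * k%:~R * x).
Proof. by rewrite freq_shift periodicz//; exact: cosD2pi. Qed.

Lemma sin_freq_periodic (k j : int) (x : R) :
  sin (pi * k%:~R * (2 * j%:~R + x)) = sin (pi * k%:~R * x).
Proof. by rewrite freq_shift periodicz//; exact: sinD2pi. Qed.

Lemma integral_derive_eq0 (F f : R -> R) :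
  continuous f -> (forall x : R, is_derive x (1 : R) F (f x)) -> F 0 = F 2 ->
  (\int[mu]_(x in D) (f x)%:E = 0)%E.
Proof.
move=> cf dF F02.
rewrite integral_itv_bndo_bndc; last first.
  apply/measurable_EFinP; apply: measurable_funTS; exact: continuous_measurable_fun.
have cF : continuous F.
  move=> x; apply: differentiable_continuous; apply/derivable1_diffP.
  exact: ex_derive.
rewrite (@continuous_FTC2 _ f F)//.
- by rewrite F02 subee.
- exact: continuous_subspaceT.
- split => [x _| |].
  + exact: ex_derive.
  + by apply: cvg_at_right_filter; exact: cF.
  + by apply: cvg_at_left_filter; exact: cF.
- by move=> x _; rewrite derive1E derive_val.
Qed.

Let is_derive_mulr (c x : R) : is_derive x (1 : R) ( *%R c) c.
Proof.
by apply: (is_derive_eq (is_deriveZ c (is_derive_id x 1))); rewrite [LHS]mulr1.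
Qed.

Let is_derive_sinM (c x : R) : is_derive x (1 : R) (fun y => sin (c * y)) (cos (c * x) * c).
Proof. exact: (is_derive1_comp (is_derive_sin _) (is_derive_mulr c x)). Qed.

Let is_derive_cosM (c x : R) : is_derive x (1 : R) (fun y => cos (c * y)) (- sin (c * x) * c).
Proof. exact: (is_derive1_comp (is_derive_cos _) (is_derive_mulr c x)). Qed.

Lemma integral_cos_freq (k : int) : k != 0 ->
  (\int[mu]_(x in D) (cos (pi * k%:~R * x))%:E = 0)%E.
Proof.
move=> k0; pose c : R := pi * k%:~R.
have c0 : c != 0 by rewrite mulf_neq0 ?intr_eq0// lt0r_neq0// pi_gt0.
apply: (integral_derive_eq0 (fun x => c^-1 * sin (c * x))).
- by apply: continuous_trig_poly; exact: trig_cos.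
- move=> x; apply: (is_derive_eq (is_deriveZ c^-1 (is_derive_sinM c x))).
  by rewrite [LHS]mulrC mulfK.
(* Periodicity between 0 and 2 gives equal endpoint values of the primitive. *)
- have := sin_freq_periodic k 1 0.
  by rewrite addr0 mulr1 -/c => ->; rewrite mulr0.
Qed.

Lemma integral_sin_freq (k : int) :
  (\int[mu]_(x in D) (sin (pi * k%:~R * x))%:E = 0)%E.
Proof.
have [->|k0] := eqVneq k 0.
  under eq_integral do rewrite mulr0 mul0r sin0.
  by rewrite integral0.
pose c : R := pi * k%:~R.
have c0 : c != 0 by rewrite mulf_neq0 ?intr_eq0// lt0r_neq0// pi_gt0.
apply: (integral_derive_eq0 (fun x => - c^-1 * cos (c * x))).
- by apply: continuous_trig_poly; exact: trig_sin.
- move=> x; apply: (is_derive_eq (is_deriveZ (- c^-1) (is_derive_cosM c x))).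
  by rewrite [LHS]mulrC mulNr mulrNN mulfK.
- have := cos_freq_periodic k 1 0.
  by rewrite addr0 mulr1 -/c => ->; rewrite mulr0.
Qed.

End trig_integrals.

Lemma adde_fin_inj {R : realDomainType} (a b c : \bar R) :
  a \is a fin_num -> (a + b = a + c)%E -> b = c.
Proof. by case: a b c => [a| |] [b| |] [c| |] // _ [] /addrI ->. Qed.

(** * Expectations of periodic functions and the square integral *)

Section wrapped_density.
Context {R : realType} {d : measure_display} {T : measurableType d}.
Context {P : probability T R} {X : {RV P >-> R}} {p : R -> R}.
Hypothesis hp : is_density X p.
Local Notation mu := (@lebesgue_measure R).
Local Notation D := (`[0%R, 2%R[%classic : set R).
Local Notation q := (periodization (EFin \o p)).
Local Open Scope ereal_scope.

Let mD : measurable (D : set (measurableTypeR R)).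
Proof. exact: measurable_itv. Qed.

Let p0 x : 0 <= (EFin \o p) x.
Proof. by case: hp => _ p0 _; rewrite lee_fin. Qed.

Let mq : measurable_fun [set: R] q.
Proof.
by apply: measurable_periodization => //; case: hp => mp _ _; exact/measurable_EFinP.
Qed.

Let q0 x : 0 <= q x.
Proof. exact: periodization_ge0. Qed.

Let muD : mu D = 2%:E.
Proof. by rewrite lebesgue_measure_itv/= lte_fin ltr0n/= -EFinB subr0. Qed.

Lemma integral_cst_period (c : R) : \int[mu]_(x in D) c%:E = (c * 2)%:E.
Proof. by rewrite integral_cst// EFinM; congr (_ * _); exact: muD. Qed.

Lemma integrable_cst_period (c : R) : mu.-integrable D (fun=> c%:E).
Proof.
apply/integrableP; split => //.
by rewrite integral_cst_period ltry.
Qed.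

Lemma periodized_density_fin_num : {ae mu, forall x, D x -> q x = (fine (q x))%:E}.
Proof.
have := integrable_ae mD (integrable_periodized_density hp).
apply: filterS.
by move=> x h /h /fineK ->.
Qed.

Let mfq : measurable_fun [set: R] (fine \o q).
Proof. exact: measurableT_comp. Qed.

Lemma integrable_fine_periodized : mu.-integrable D (EFin \o (fine \o q)).
Proof.
apply: le_integrable (integrable_periodized_density hp) => //.
  by apply: measurable_funTS; exact/measurable_EFinP.
by move=> x _ /=; case: (q x) => [s| |] //=; rewrite normr0 leey.
Qed.

(** The constant 1/2 is the uniform density on a period of length 2. Where [q] is infinite, [fine]
    returns 0; within [D] this happens only on a null set. *)
Definition density_deviation (x : R) : R := (fine (q x) - 1 / 2)%R.
Local Notation r := density_deviation.

Lemma integrable_density_deviation : mu.-integrable D (EFin \o r).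
Proof. exact: (integrableB mD integrable_fine_periodized (integrable_cst_period _)). Qed.

Lemma integral_fine_periodized (g : R -> R) : measurable_fun [set: R] g ->
  (forall x, 0 <= g x)%R ->
  \int[mu]_(x in D) ((g x)%:E * q x) = \int[mu]_(x in D) (g x * fine (q x))%:E.
Proof.
move=> mg g0; have mgE : measurable_fun [set: R] (EFin \o g) by exact/measurable_EFinP.
apply: ge0_ae_eq_integral => //.
- by apply: measurable_funTS; exact: emeasurable_funM.
- by apply/measurable_EFinP/measurable_funTS; exact: measurable_funM.
- by move=> x _; rewrite mule_ge0// lee_fin.
- by move=> x _; rewrite lee_fin mulr_ge0// fine_ge0.
apply: (@filterS _ _ (ae_filter_ringOfSetsType mu) _ _ _ periodized_density_fin_num) => x h Dx.
by rewrite [in LHS]h.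
Qed.

Lemma integral_fine_periodized1 : \int[mu]_(x in D) (fine (q x))%:E = 1.
Proof.
rewrite -(integral_periodized_density hp).
have := @integral_fine_periodized (fun=> 1%R) (measurable_cst _) (fun=> ler01).
under eq_integral do rewrite mul1e.
by under [in RHS]eq_integral do rewrite mul1r.
Qed.

Section periodic_test.
Variable g : R -> R.
Hypothesis mg : measurable_fun [set: R] g.
Hypothesis g1 : forall x, (`|g x| <= 1)%R.
Hypothesis gper : forall (k : int) x, (g (2 * k%:~R + x) = g x)%R.

Let bg (A : set R) : [bounded g x | x in A].
Proof.
exists 1%R; split; rewrite ?num_real// => M M1 x _ /=.
exact: le_trans (g1 x) (ltW M1).
Qed.

Lemma integrable_periodic_mul (f : R -> R) : mu.-integrable D (EFin \o f) ->
  mu.-integrable D (fun x => (g x * f x)%:E).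
Proof.
move=> fi; have := integrableMr mD (measurable_funTS mg) (bg D) fi.
by apply: eq_integrable => // x _.
Qed.

Lemma expectation_periodic :
  'E_P[g \o X] = \int[mu]_(x in D) (g x * fine (q x))%:E.
Proof.
have mgX : measurable_fun [set: T] (g \o X).
  by apply: measurableT_comp => //; exact: measurable_funP X.
have Pg : P.-integrable [set: T] (EFin \o (g \o X)).
  apply: measurable_bounded_integrable => //.
    exact: (le_lt_trans (probability_le1 P measurableT) (ltry 1)).
  exists 1%R; split; rewrite ?num_real// => M M1 x _ /=.
  exact: le_trans (g1 _) (ltW M1).
(* The unfolding formula is for nonnegative functions, hence the shift by 1. *)
pose G x := (1 + g x)%R.
have mG : measurable_fun [set: R] G by exact: measurable_funD.
have G0 x : (0 <= G x)%R by have := g1 x; rewrite ler_norml /G; lra.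
have Gper (k : int) x : ((G (2 * k%:~R + x))%:E = (G x)%:E) by rewrite /G gper.
have mGE : measurable_fun [set: R] (EFin \o G) by exact/measurable_EFinP.
have EG : \int[P]_w (G (X w))%:E = 1 + 'E_P[g \o X].
  under eq_integral do rewrite /G EFinD.
  rewrite integralD//; last first.
    exact: finite_measure_integrable_cst.
  rewrite integral_cst// mul1e unlock; congr (_ + _); exact: probability_setT.
have := ge0_integral_density hp (EFin \o G) mGE G0.
rewrite /= EG (ge0_integral_periodic_density hp)//.
rewrite integral_fine_periodized//.
under eq_integral do rewrite /G mulrDl mul1r EFinD.
rewrite integralD//; last 2 first.
- exact: integrable_fine_periodized.
- exact: integrable_periodic_mul integrable_fine_periodized.
(* The shift contributes the total mass 1 on both sides; being finite, it cancels. *)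
rewrite integral_fine_periodized1; exact: adde_fin_inj.
Qed.

(** Splits [q] as [r + 1/2]; the uniform part disappears for every [g] of mean zero, in particular
    for nonconstant cosines and sines. *)
Lemma expectation_periodic_deviation :
  'E_P[g \o X] = \int[mu]_(x in D) (g x * r x)%:E + (1 / 2)%:E * \int[mu]_(x in D) (g x)%:E.
Proof.
have ig : mu.-integrable D (EFin \o g).
  apply: measurable_bounded_integrable.
  - exact: mD.
  - by rewrite [ltLHS]muD ltry.
  - exact: measurable_funTS.
  - exact: bg.
rewrite expectation_periodic -integralZl// -integralD//=; last 2 first.
- exact: integrable_periodic_mul integrable_density_deviation.
- exact: integrableZl.
apply: eq_integral => x _; rewrite -EFinM -EFinD /r; congr EFin; lra.
Qed.

End periodic_test.

Lemma integral_density_deviation : \int[mu]_(x in D) (r x)%:E = 0.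
Proof.
under eq_integral do rewrite /r EFinB.
rewrite integralB//; [|exact: integrable_fine_periodized|exact: integrable_cst_period].
by rewrite integral_fine_periodized1 integral_cst_period divfK ?subee// pnatr_eq0.
Qed.

Lemma integral_sqr_periodized :
  (\int[mu]_(x in D) (q x * q x) = (1 / 2)%:E) <-> {ae mu, forall x, D x -> r x = 0%R}.
Proof.
have mr : measurable_fun D r.
  by apply/measurable_EFinP; exact: measurable_int integrable_density_deviation.
have mr2 : measurable_fun D (fun x => (r x ^+ 2)%:E).
  by apply/measurable_EFinP; exact: measurable_funX.
have mqq : measurable_fun D (fun x => q x * q x).
  by apply: measurable_funTS; exact: emeasurable_funM.
have mqD : measurable_fun D q by exact: measurable_funTS.
have qq0 x : D x -> 0 <= q x * q x by move=> _; exact: mule_ge0.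
have r20 x : D x -> 0 <= (r x ^+ 2)%:E by rewrite lee_fin sqr_ge0.
have c0 x : D x -> 0 <= (1 / 4 : R)%:E by rewrite lee_fin; lra.
split=> [h|r_ae].
(* This integrates [q ^ 2 + 1/4 = r ^ 2 + q], arranged with nonnegative terms only, so that
   additivity requires no integrability of the squares. *)
- have e : \int[mu]_(x in D) (q x * q x) + \int[mu]_(x in D) (1 / 4)%:E =
      \int[mu]_(x in D) (r x ^+ 2)%:E + \int[mu]_(x in D) q x.
    rewrite -!ge0_integralD//.
    apply: ge0_ae_eq_integral => //.
    + by apply: emeasurable_funD.
    + by apply: emeasurable_funD.
    + by move=> x Dx; apply: adde_ge0; [exact: qq0|exact: c0 Dx].
    + by move=> x Dx; apply: adde_ge0; [exact: r20|].
    apply: (@filterS _ _ (ae_filter_ringOfSetsType mu) _ _ _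
      periodized_density_fin_num) => x qx Dx.
    rewrite /r (qx Dx)/= -EFinM -!EFinD; congr EFin; rewrite expr2; lra.
  have ir2 : \int[mu]_(x in D) (r x ^+ 2)%:E = 0.
    move: e; rewrite h integral_cst_period (integral_periodized_density hp) -EFinD.
    (* The left side equals the mass 1 of [q], which leaves 0 for the integral of [r ^ 2]. *)
    rewrite (_ : (1 / 2 + 1 / 4 * 2)%R%:E = 1 + 0 :> \bar R); last first.
      by rewrite adde0; congr EFin; lra.
    by rewrite [RHS]addeC => /adde_fin_inj/esym; apply.
  have /(ae_eq_integral_abs _ mD mr2) : \int[mu]_(x in D) `|(r x ^+ 2)%:E| = 0.
    by under eq_integral do rewrite gee0_abs ?lee_fin ?sqr_ge0//.
  apply: filterS => x h0 /h0 /= /eqP.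
  by rewrite eqe sqrf_eq0 => /eqP.
- transitivity (\int[mu]_(x in D) (1 / 4)%:E); last first.
    by rewrite integral_cst_period; congr EFin; lra.
  apply: ge0_ae_eq_integral => //.
  apply: filterS2 periodized_density_fin_num r_ae; first exact: (ae_filter_ringOfSetsType mu).
  move=> x qx rx Dx.
  have := rx Dx; rewrite /r (qx Dx)/= => h.
  by rewrite -EFinM; congr EFin; nra.
Qed.

End wrapped_density.

(** * Vanishing of [f] at [pi * k] and Fourier coefficients of the deviation *)

Theorem corollary6p4 (R : realType) (d : measure_display)
    (T : measurableType d) (P : probability T R) (X : {RV P >-> R})
    (p : R -> R) (hp : is_density X p)
    (hTV : (total_variation_line p < +oo)%E) :
  (forall k : int, k != 0 -> char_fun X (pi * k%:~R) = 0) <->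
  (\esum_(k in [set: int])
     \int[lebesgue_measure]_x (p (2 * k%:~R + x) * p x)%:E = (1 / 2)%:E)%E.
Proof.
set mu := @lebesgue_measure R.
set D := (`[0%R, 2%R[%classic : set R).
pose r := density_deviation (p := p).
have ir : mu.-integrable D (EFin \o r) := integrable_density_deviation hp.
have mcos (k : int) : measurable_fun [set: R] (fun x => cos (pi * k%:~R * x)).
  by apply: measurable_trig; exact: trig_cos.
have msin (k : int) : measurable_fun [set: R] (fun x => sin (pi * k%:~R * x)).
  by apply: measurable_trig; exact: trig_sin.
have Ecos (k : int) : k != 0 -> ('E_P[(fun x => cos (pi * k%:~R * x)) \o X] =
    \int[mu]_(x in D) (cos (pi * k%:~R * x) * r x)%:E)%E.
  move=> k0; rewrite (expectation_periodic_deviation hp) ?integral_cos_freq ?mule0 ?adde0//.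
  - by move=> x; exact: cos_max.
  - by move=> j x; exact: cos_freq_periodic.
have Esin (k : int) : ('E_P[(fun x => sin (pi * k%:~R * x)) \o X] =
    \int[mu]_(x in D) (sin (pi * k%:~R * x) * r x)%:E)%E.
  rewrite (expectation_periodic_deviation hp) ?integral_sin_freq ?mule0 ?adde0//.
  - by move=> x; exact: sin_max.
  - by move=> j x; exact: sin_freq_periodic.
rewrite (esum_correlation hp) (integral_sqr_periodized hp) -/r -/mu -/D; split.
- move=> f0; apply: fourier_coef_eq0_ae => // k.
  (* The hypothesis says nothing at frequency 0; there the coefficient vanishes because [q] and the
     uniform density have the same mass. *)
  + have [->|k0] := eqVneq k 0.
      under eq_integral do rewrite mulr0 mul0r cos0 mul1r.
      exact: (integral_density_deviation hp).
    have := f0 k k0; rewrite /char_fun /cexpectation => -[+ _].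
    rewrite [X in fine X](Ecos k k0) => /eqP.
    (* Since [fine] is also 0 at infinite values, finiteness of the integral has to be supplied. *)
    rewrite fine_eq0; first by move=> /eqP.
    apply: integrable_fin_num (integrable_trig_mul _ ir _ (trig_cos k)).
    exact: measurable_itv.
  + have [->|k0] := eqVneq k 0.
      under eq_integral do rewrite mulr0 mul0r sin0 mul0r.
      exact: integral0.
    have := f0 k k0; rewrite /char_fun /cexpectation => -[_ +].
    rewrite [X in fine X](Esin k) => /eqP.
    rewrite fine_eq0; first by move=> /eqP.
    apply: integrable_fin_num (integrable_trig_mul _ ir _ (trig_sin k)).
    exact: measurable_itv.
- move=> r0 k k0; rewrite /char_fun /cexpectation.
  have z (g : R -> R) : trig_poly g -> (\int[mu]_(x in D) (g x * r x)%:E = 0)%E.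
    move=> tg; rewrite -(@integral0 _ _ _ mu D); apply: ae_eq_integral => //.
    - exact: measurable_itv.
    - exact: measurable_int (integrable_trig_mul _ ir _ tg).
    - by apply: (@filterS _ _ (ae_filter_ringOfSetsType mu) _ _ _ r0) => x h Dx;
      rewrite h// mulr0.
  rewrite [X in (fine X +i* _)%C](Ecos k k0) [X in (_ +i* fine X)%C](Esin k).
  by rewrite !z//; [exact: trig_sin|exact: trig_cos].
Qed.
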